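(* The category $\mathbf{DM}$ of De Morgan algebras and their homomorphisms is dually equivalent to the category $\mathbf{DMSpec}$ of De Morgan spectral spaces and spectral frame morphisms.
   Context: A De Morgan algebra is a bounded distributive lattice $\langle A;\wedge,\vee,0,1\rangle$ with a unary operation $-$ such that $a\leq b$ implies $-b\leq -a$, and $--a=a$. Homomorphisms preserve $\wedge,\vee,-,0,1$. For a topological space $X$, $\Omega(X)$ is the set of compact open subsets of $X$, and the specialization order is: $x\leqslant y$ iff every open set containing $x$ contains $y$. A spectral space is a compact, $T_0$, sober space $X$ such that $\Omega(X)$ is closed under finite intersections and is a basis for $X$ (sober: every completely prime filter of the lattice of open sets is the set of open neighbourhoods of some point). A map $f\colon X\to Y$ of spectral spaces is a spectral map if $f^{-1}[U]\in\Omega(X)$ for each $U\in\Omega(Y)$. A De Morgan spectral space is $\langle X;g,\tau\rangle$ where $\langle X;\tau\rangle$ is a spectral space, $g\colon X\to X$ is an order-inverting involution with respect to the specialization order, and $U^*:=\{x\in X:g(x)\notin U\}\in\Omega(X)$ for every $U\in\Omega(X)$. A spectral frame morphism between De Morgan spectral spaces $X$, $X'$ is a spectral map $f\colon X\to X'$ with $f(g(x))=g(f(x))$ for all $x\in X$. *)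

(* Defs.v *)
From HB Require Import structures.
From mathcomp Require Import all_boot all_order.
From mathcomp Require Import boolp classical_sets filter topology.

Set Implicit Arguments.
Unset Strict Implicit.
Unset Printing Implicit Defensive.

Import Order.TTheory.
Local Open Scope classical_set_scope.
Local Open Scope order_scope.

(* Hom-sets are compared with Leibniz equality, which is the intended equality
   of morphisms thanks to functional extensionality and proof irrelevance. *)
Record category := Category {
  obj :> Type;
  hom : obj -> obj -> Type;
  idc : forall a, hom a a;
  comp : forall a b c, hom b c -> hom a b -> hom a c;
  comp1c : forall a b (f : hom a b), comp (idc b) f = f;
  compc1 : forall a b (f : hom a b), comp f (idc a) = f;
  compcA : forall a b c d (h : hom c d) (g : hom b c) (f : hom a b),
    comp h (comp g f) = comp (comp h g) f
}.
Arguments idc {c0} a.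
Arguments comp {c0 a b c} g f.

Definition opposite (C : category) : category :=
  @Category C (fun a b => hom b a) (fun a => idc a)
    (fun a b c g f => comp f g)
    (fun a b f => compc1 f) (fun a b f => comp1c f)
    (fun a b c d h g f => esym (compcA f g h)).

Record functor (C D : category) := Functor {
  fobj :> C -> D;
  fmap : forall a b : C, hom a b -> hom (fobj a) (fobj b);
  fmap1 : forall a : C, fmap (idc a) = idc (fobj a);
  fmapM : forall (a b c : C) (g : hom b c) (f : hom a b),
    fmap (comp g f) = comp (fmap g) (fmap f)
}.

Definition idfunctor (C : category) : functor C C :=
  @Functor C C id (fun a b f => f) (fun=> erefl) (fun a b c g f => erefl).

Definition compfunctor (C D E : category) (G : functor D E) (F : functor C D) :
    functor C E :=
  @Functor C E (fun a => G (F a)) (fun a b f => fmap G (fmap F f))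
    (fun a => etrans (congr1 (fmap G (b:=_)) (fmap1 F a)) (fmap1 G (F a)))
    (fun a b c g f => etrans (congr1 (fmap G (b:=_)) (fmapM F g f))
                             (fmapM G (fmap F g) (fmap F f))).

Definition isomorphism (C : category) (a b : C) (f : hom a b) : Prop :=
  exists g : hom b a, comp g f = idc a /\ comp f g = idc b.

Definition naturally_isomorphic (C D : category) (F G : functor C D) : Prop :=
  exists eta : forall a : C, hom (F a) (G a),
    (forall (a b : C) (f : hom a b),
       comp (eta b) (fmap F f) = comp (fmap G f) (eta a)) /\
    (forall a : C, isomorphism (eta a)).

Definition equivalent (C D : category) : Prop :=
  exists (F : functor C D) (G : functor D C),
    naturally_isomorphic (idfunctor C) (compfunctor G F) /\
    naturally_isomorphic (compfunctor F G) (idfunctor D).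

Definition dually_equivalent (C D : category) : Prop :=
  equivalent (opposite C) D.

HB.mixin Record isDeMorgan (d : Order.disp_t) (A : Type)
    of Order.TBDistrLattice d A := {
  dmneg : A -> A;
  dmneg_anti : forall a b : A, a <= b -> dmneg b <= dmneg a;
  dmnegK : involutive dmneg
}.

#[short(type="deMorganType")]
HB.structure Definition DeMorgan (d : Order.disp_t) :=
  {A of Order.TBDistrLattice d A & isDeMorgan d A}.

(* MathComp's {tblmorphism A -> B} does not include preservation of meets and
   joins, so it cannot be used as the base of this structure. *)
Record dmhom (d d' : Order.disp_t) (A : deMorganType d) (B : deMorganType d') :=
  DMHom {
    dmhom_fun :> A -> B;
    dmhomI : Order.meet_morphism dmhom_fun;
    dmhomU : Order.join_morphism dmhom_fun;
    dmhomN : {morph dmhom_fun : a / dmneg a};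
    dmhom0 : dmhom_fun \bot = \bot;
    dmhom1 : dmhom_fun \top = \top
  }.

Lemma dmhom_ext d d' (A : deMorganType d) (B : deMorganType d')
  (f g : dmhom A B) : (forall a, f a = g a) -> f = g.
Proof.
case: f g => [f fI fU fN f0 f1] [g gI gU gN g0 g1] /= /funext fg.
by case: g / fg in gI gU gN g0 g1 *; f_equal; exact: Prop_irrelevance.
Qed.

Definition dmhom_id d (A : deMorganType d) : dmhom A A :=
  @DMHom d d A A id (fun _ _ => erefl) (fun _ _ => erefl) (fun=> erefl)
    erefl erefl.

Definition dmhom_comp d1 d2 d3 (A : deMorganType d1) (B : deMorganType d2)
  (C : deMorganType d3) (g : dmhom B C) (f : dmhom A B) : dmhom A C.
Proof.
exists (g \o f) => [a b|a b|a||] /=.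
- by rewrite !dmhomI.
- by rewrite !dmhomU.
- by rewrite !dmhomN.
- by rewrite !dmhom0.
- by rewrite !dmhom1.
Defined.

(* MathComp orders carry a display, which only controls notations; the objects
   of DM all use this one. *)
Fact demorgan_display : Order.disp_t. Proof. exact: Order.Disp tt tt. Qed.

Definition DM : category.
Proof.
refine (@Category (deMorganType demorgan_display) (@dmhom _ _)
  (@dmhom_id _) (@dmhom_comp _ _ _) _ _ _).
- by move=> A B f; apply: dmhom_ext.
- by move=> A B f; apply: dmhom_ext.
- by move=> A B C D h g f; apply: dmhom_ext.
Defined.

Section Spectral.
Variable X : topologicalType.

Definition compact_opens : set (set X) := [set U | compact U /\ open U].

Definition specialization (x y : X) : Prop :=
  forall U : set X, open U -> U x -> U y.

(* [cpf_prime] applied to the empty family shows that such a filter is proper. *)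
Record completely_prime_filter (F : set (set X)) : Prop := {
  cpf_open : F `<=` open;
  cpfT : F setT;
  cpf_up : forall U V : set X, F U -> open V -> U `<=` V -> F V;
  cpfI : setI_closed F;
  cpf_prime : forall D : set (set X), D `<=` open ->
    F (\bigcup_(U in D) U) -> exists2 U, D U & F U
}.

Definition sober : Prop := forall F : set (set X),
  completely_prime_filter F -> exists x : X, F = open_nbhs x.

End Spectral.
Arguments compact_opens X : clear implicits.
Arguments sober X : clear implicits.

HB.mixin Record isSpectral (X : Type) of Topological X := {
  spectral_compact : compact [set: X];
  spectral_kolmogorov : kolmogorov_space X;
  spectral_sober : sober X;
  spectral_setI : setI_closed (compact_opens X);
  spectral_basis : basis (compact_opens X)
}.

#[short(type="spectralType")]
HB.structure Definition Spectral := {X of Topological X & isSpectral X}.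

Definition spectral_map (X Y : topologicalType) (f : X -> Y) : Prop :=
  forall U : set Y, compact_opens Y U -> compact_opens X (f @^-1` U).

HB.mixin Record isDeMorganSpectral (X : Type) of Spectral X := {
  dminv : X -> X;
  dminv_anti : forall x y : X,
    specialization x y -> specialization (dminv y) (dminv x);
  dminvK : involutive dminv;
  dminv_star : forall U : set X,
    compact_opens X U -> compact_opens X [set x | ~ U (dminv x)]
}.

#[short(type="deMorganSpectralType")]
HB.structure Definition DeMorganSpectral :=
  {X of Spectral X & isDeMorganSpectral X}.

Record spectral_frame_morphism (X Y : deMorganSpectralType) :=
  SpectralFrameMorphism {
    sfm_fun :> X -> Y;
    sfm_spectral : spectral_map sfm_fun;
    sfm_dminv : {morph sfm_fun : x / dminv x}
  }.

Lemma sfm_ext (X Y : deMorganSpectralType) (f g : spectral_frame_morphism X Y) :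
  (forall x, f x = g x) -> f = g.
Proof.
case: f g => [f fs fi] [g gs gi] /= /funext fg.
by case: g / fg in gs gi *; f_equal; exact: Prop_irrelevance.
Qed.

Definition sfm_id (X : deMorganSpectralType) : spectral_frame_morphism X X :=
  @SpectralFrameMorphism X X id (fun U KU => KU) (fun=> erefl).

Definition sfm_comp (X Y Z : deMorganSpectralType)
  (g : spectral_frame_morphism Y Z) (f : spectral_frame_morphism X Y) :
  spectral_frame_morphism X Z.
Proof.
exists (g \o f) => [U KU|x] /=.
- exact: (sfm_spectral f (sfm_spectral g KU)).
- by rewrite !sfm_dminv.
Defined.

Definition DMSpec : category.
Proof.
refine (@Category deMorganSpectralType spectral_frame_morphism
  sfm_id sfm_comp _ _ _).
- by move=> X Y f; apply: sfm_ext.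
- by move=> X Y f; apply: sfm_ext.
- by move=> X Y Z W h g f; apply: sfm_ext.
Defined.

(* Main.v *)
Require Import Defs.
From HB Require Import structures.
From mathcomp Require Import all_boot all_order.
From mathcomp Require Import boolp classical_sets filter topology.

Set Implicit Arguments.
Unset Strict Implicit.
Unset Printing Implicit Defensive.

Import Order.TTheory.
Local Open Scope classical_set_scope.

(* Priestley-Stone duality in its spectral form: a De Morgan algebra [A] is sent
   to its prime filters, with the sets [{P | a \in P}] as a basis and the
   involution [P |-> {a | - a \notin P}]; a De Morgan spectral space is sent to
   its lattice of compact open sets, with [U^*] as negation. Ultrafilters are
   prime, so an ultrafilter on the spectrum traces a prime filter on [A] to which
   it converges: this gives compactness. Zorn's lemma is needed only to separate
   elements of [A] by prime filters. *)

(** * Prime filters of a bounded distributive lattice *)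

Section PrimeFilter.
Local Open Scope order_scope.
Context {d : Order.disp_t} {A : tbDistrLatticeType d}.

Record prime_filter := PrimeFilter {
  pf_set :> A -> Prop;
  pf0 : ~ pf_set \bot;
  pf1 : pf_set \top;
  pfI : forall a b, pf_set (a `&` b) <-> pf_set a /\ pf_set b;
  pfU : forall a b, pf_set (a `|` b) <-> pf_set a \/ pf_set b
}.

Lemma pf_ext (P Q : prime_filter) : (forall a, P a <-> Q a) -> P = Q.
Proof.
case: P Q => [P P0 P1 PI PU] [Q Q0 Q1 QI QU] /= PQ.
have {}PQ : P = Q by apply/seteqP; split=> a /PQ.
by case: Q / PQ in Q0 Q1 QI QU *; f_equal; exact: Prop_irrelevance.
Qed.

Lemma pf_le (P : prime_filter) a b : a <= b -> P a -> P b.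
Proof. by move=> /meet_l <- /pfI[]. Qed.

(** By Zorn's lemma there is a filter [M] maximal among those containing [a] and avoiding [b], and
    distributivity makes it prime: if [x] and [y] are outside [M], then some [m], [n] in [M] have
    both [m] meet [x] and [n] meet [y] below [b]. The meet of [m], [n] and the join of [x] and [y]
    is then below [b] too, so this join is outside [M]. *)
Lemma prime_filter_separation (a b : A) : ~~ (a <= b) ->
  exists2 P : prime_filter, P a & ~ P b.
Proof.
move=> ab; pose filt (S : set A) := [/\ S a, ~ S b,
  forall x y, S x -> x <= y -> S y & forall x y, S x -> S y -> S (x `&` y)].
(* [set0] is admitted because of the empty chain. *)
have [F FP totF|M [Mfilt Mmax]] := @Zorn_bigcup A [set S | S = set0 \/ filt S].
  have [F0|] := pselect (F `<=` [set set0]).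
    by left; apply/seteqP; split=> // x [S /F0 ->].
  move=> /nonsubset[S [FS /eqP/= /eqP S0]]; right; split.
  - by have [//|[Sa _ _ _]] := FP _ FS; exists S.
  - by move=> [T FT Tb]; have [T0|[]//] := FP _ FT; rewrite T0 in Tb.
  - move=> x y [T FT Tx] xy; exists T => //.
    by have [T0|[_ _ up _]] := FP _ FT; [rewrite T0 in Tx|exact: up xy].
  - move=> x y [T FT Tx] [U FU Uy].
    have stable V : F V -> V x -> V y -> V (x `&` y).
      by move=> FV Vx Vy; have [V0|[_ _ _ VI]] := FP _ FV;
        [rewrite V0 in Vx|exact: VI].
    have [TU|UT] := totF _ _ FT FU.
    + by exists U => //; apply: stable => //; exact: TU.
    + by exists T => //; apply: stable => //; exact: UT.
have maxM S : filt S -> M `<=` S -> S `<=` M.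
  move=> Sfilt MS; apply: contrapT => nSM.
  by apply: (Mmax S) => //; right.
have [Ma Mb Mup MI] : filt M.
  case: Mfilt => // M0; have up : filt [set x | a <= x].
    split=> /=; [by []|exact/negP|by move=> x y; exact: le_trans|].
    by move=> x y ax ay; rewrite lexI ax.
  have /(_ a (lexx a)) : [set x | a <= x] `<=` M by apply: maxM => //; rewrite M0.
  by rewrite M0.
(* The set used below is the filter generated by [M] and [x]. If it avoided [b], maximality would
   put [x] in [M]. *)
have adjoin x : ~ M x -> exists2 m, M m & m `&` x <= b.
  move=> nMx; apply: contrapT => nb; apply: nMx.
  apply: (maxM [set y | exists2 m, M m & m `&` x <= y]) => /=.
  - split=> /=; [by exists a => //; exact: leIl|exact: nb| |].
      by move=> y z [m Mm my] yz; exists m => //; exact: le_trans yz.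
    move=> y z [m Mm my] [n Mn nz]; exists (m `&` n); first exact: MI.
    by rewrite lexI (le_trans _ my) ?(le_trans _ nz) // leI2 ?leIl ?leIr.
  - by move=> m Mm; exists m => //; exact: leIl.
  - by exists a => //; exact: leIr.
have MIP x y : M (x `&` y) <-> M x /\ M y.
  split=> [Mxy|[]]; last exact: MI.
  by split; apply: Mup Mxy _; rewrite ?leIl ?leIr.
have MUP x y : M (x `|` y) <-> M x \/ M y.
  split=> [Mxy|[Mx|My]]; [|exact: Mup Mx (leUl _ _)|exact: Mup My (leUr _ _)].
  apply: contrapT => /not_orP[/adjoin[m Mm mx] /adjoin[n Mn ny]].
  apply: Mb; apply: Mup (MI _ _ (MI _ _ Mm Mn) Mxy) _.
  rewrite meetUr leUx (le_trans _ mx) ?(le_trans _ ny) //.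
    by rewrite leI2 // leIr.
  by rewrite leI2 // leIl.
have M1 : M \top by apply: Mup Ma _; exact: lex1.
have M0 : ~ M \bot by move=> M0; apply: Mb; apply: Mup M0 _; exact: le0x.
by exists (PrimeFilter M0 M1 MIP MUP).
Qed.

End PrimeFilter.
Arguments prime_filter {d} A.

(** If no member of [D] covers [K], the sets [K] minus [U] generate a proper filter, directedness
    giving the finite intersections. A cluster point in [K] lies in some [U] of [D], a neighbourhood
    that misses [K] minus [U]: a contradiction. *)
Lemma compact_directed_cover (X : topologicalType) (K : set X)
    (D : set (set X)) : compact K -> D `<=` open -> D !=set0 ->
  (forall U V, D U -> D V -> exists2 W, D W & U `|` V `<=` W) ->
  K `<=` \bigcup_(U in D) U -> exists2 U, D U & K `<=` U.
Proof.
move=> cK Dop D0 Ddir KD; apply: contrapT => nK.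
have [||x [Kx xcl]] := cK (filter_from D (fun U => K `&` ~` U)).
- apply: filter_from_proper; last first.
    move=> U DU; apply/set0P/negP => /eqP KU0; apply: nK.
    by exists U => // x Kx; apply: contrapT => nUx; rewrite -[False]/(set0 x) -KU0.
  apply: filter_from_filter => // U V DU DV.
  by have [W DW UVW] := Ddir _ _ DU DV; exists W => // x [Kx nWx];
    split; split=> // ?; apply: nWx; apply: UVW; [left|right].
- by case: D0 => U DU; exists U => // x [].
have [U DU Ux] := KD _ Kx.
have [||y [[_ nUy] Uy]] := xcl (K `&` ~` U) U; [by exists U| |by []].
by apply: open_nbhs_nbhs; split=> //; exact: Dop.
Qed.

(** * The space of prime filters is spectral *)

Section Spectrum.
Context {d : Order.disp_t} {A : tbDistrLatticeType d}.
Implicit Types (a b : A) (P Q : prime_filter A).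

HB.instance Definition _ := gen_eqMixin (prime_filter A).
HB.instance Definition _ := gen_choiceMixin (prime_filter A).

Definition basic_open a : set (prime_filter A) := [set P | P a].

Definition spectrum_open (O : set (prime_filter A)) : Prop :=
  forall P, O P -> exists2 a, P a & basic_open a `<=` O.

Let spectrum_openT : spectrum_open setT.
Proof. by move=> P _; exists \top%O => //; exact: pf1. Qed.

Let spectrum_openI : setI_closed spectrum_open.
Proof.
move=> O O' oO oO' P [/oO[a Pa aO] /oO'[b Pb bO']]; exists (a `&` b)%O.
  exact/pfI.
by move=> Q /pfI[Qa Qb]; split; [exact: aO|exact: bO'].
Qed.

Let spectrum_open_bigU (I : Type) (f : I -> set (prime_filter A)) :
  (forall i, spectrum_open (f i)) -> spectrum_open (\bigcup_i f i).
Proof.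
move=> of_ P [i _ /of_[a Pa af]]; exists a => // Q Qa.
by exists i => //; exact: af.
Qed.

HB.instance Definition _ := isOpenTopological.Build (prime_filter A)
  spectrum_openT spectrum_openI spectrum_open_bigU.

Lemma basic_openI a b : basic_open (a `&` b)%O = basic_open a `&` basic_open b.
Proof. by apply/seteqP; split=> P /pfI. Qed.

Lemma basic_openU a b : basic_open (a `|` b)%O = basic_open a `|` basic_open b.
Proof. by apply/seteqP; split=> P /pfU. Qed.

Lemma basic_open0 : basic_open \bot%O = set0.
Proof. by apply/seteqP; split=> P // /pf0. Qed.

Lemma basic_open1 : basic_open \top%O = setT.
Proof. by apply/seteqP; split=> P // _; exact: pf1. Qed.

(** This is where separation by prime filters enters; it makes the unit on algebras injective. *)
Lemma basic_open_le a b : basic_open a `<=` basic_open b -> (a <= b)%O.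
Proof.
move=> ab; apply: contrapT => /negP /prime_filter_separation[P Pa].
by apply; exact: ab.
Qed.

Lemma open_basic_open a : open (basic_open a).
Proof. by move=> P Pa; exists a. Qed.

Lemma compact_basic_open a : compact (basic_open a).
Proof.
rewrite compact_ultra => F FU Fa.
have F0 : ~ F (basic_open \bot%O) by rewrite basic_open0; exact: filter_not_empty.
have F1 : F (basic_open \top%O) by rewrite basic_open1; exact: filterT.
have FI b c : F (basic_open (b `&` c)%O) <-> F (basic_open b) /\ F (basic_open c).
  rewrite basic_openI; split=> [Fbc|[]]; last exact: filterI.
  by split; apply: filterS Fbc => ? [].
(* Primeness of the trace comes from [F] being an ultrafilter: it contains [basic_open b] or its
   complement, and the latter cuts the union down to a part of [basic_open c]. *)
have FUP b c : F (basic_open (b `|` c)%O) <-> F (basic_open b) \/ F (basic_open c).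
  rewrite basic_openU; split=> [Fbc|[]]; last 2 first.
    by apply: filterS; left.
    by apply: filterS; right.
  have [|Fb] := in_ultra_setVsetC (basic_open b) FU; first by left.
  by right; apply: filterS (filterI Fbc Fb) => P [[]].
exists (PrimeFilter (pf_set := [set b | F (basic_open b)]) F0 F1 FI FUP).
split=> // O; rewrite nbhsE => -[O' [oO' /oO'[b Fb bO']] O'O].
by apply: filterS Fb; exact: subset_trans O'O.
Qed.

(** An open set is the union of the basic opens it contains. These form a directed family by
    [basic_openU], so when the set is compact a single one of them exhausts it. *)
Lemma compact_opensE K :
  compact_opens (prime_filter A) K <-> exists a, K = basic_open a.
Proof.
split=> [[cK oK]|[a ->]]; last first.
  by split; [exact: compact_basic_open|exact: open_basic_open].
have [||||_ [a aK <-] Ka] :=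
    @compact_directed_cover _ K [set U | exists2 a, basic_open a `<=` K
                                                  & basic_open a = U] cK.
- by move=> _ [a _ <-]; exact: open_basic_open.
- by exists (basic_open \bot%O); exists \bot%O => //; rewrite basic_open0.
- move=> _ _ [a aK <-] [b bK <-]; exists (basic_open (a `|` b)%O).
    by exists (a `|` b)%O => //; rewrite basic_openU subUset.
  by rewrite basic_openU.
- move=> P /oK[a Pa aK]; exists (basic_open a) => //.
  by exists a.
by exists a; apply/seteqP.
Qed.

Let spectrum_compact : compact [set: prime_filter A].
Proof. by rewrite -basic_open1; exact: compact_basic_open. Qed.

Let spectrum_kolmogorov : kolmogorov_space (prime_filter A).
Proof.
move=> P Q /eqP PQ; have nbhs_basic (R : prime_filter A) a : R a -> basic_open a \in nbhs R.
  by move=> Ra; rewrite inE; apply: open_nbhs_nbhs; split=> //;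
    exact: open_basic_open.
have [PsubQ|/nonsubset[a [Pa Qa]]] := pselect (pf_set P `<=` pf_set Q); last first.
  by exists (basic_open a); left; rewrite nbhs_basic // inE.
have [QsubP|/nonsubset[a [Qa Pa]]] := pselect (pf_set Q `<=` pf_set P); last first.
  by exists (basic_open a); right; rewrite nbhs_basic // inE.
by case: PQ; apply: pf_ext => a; split=> [/PsubQ|/QsubP].
Qed.

(** The point is the trace of [F] on basic opens. Complete primeness for the empty family keeps
    [\bot] out of it, and for two-element families it makes the trace prime. *)
Let spectrum_sober : sober (prime_filter A).
Proof.
move=> F [Fo FT Fup FI Fpr].
have F0 : ~ F (basic_open \bot%O).
  rewrite basic_open0 => F0; have [||//] := Fpr set0; first by [].
  by rewrite bigcup_set0.
have F1 : F (basic_open \top%O) by rewrite basic_open1.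
have FIP b c : F (basic_open (b `&` c)%O) <-> F (basic_open b) /\ F (basic_open c).
  rewrite basic_openI; split=> [Fbc|[]]; last exact: FI.
  by split; apply: Fup Fbc (@open_basic_open _) _ => ? [].
have FUP b c : F (basic_open (b `|` c)%O) <-> F (basic_open b) \/ F (basic_open c).
  split; last first.
    by case=> Fb; apply: Fup Fb (@open_basic_open _) _; rewrite basic_openU => ?;
      [left|right].
  have -> : basic_open (b `|` c)%O =
            \bigcup_(U in [set basic_open b; basic_open c]) U.
    by rewrite bigcup_setU !bigcup_set1 basic_openU.
  move=> /Fpr[_ [] ->|_ [->|->]]; try exact: open_basic_open; by [left|right].
exists (PrimeFilter (pf_set := [set b | F (basic_open b)]) F0 F1 FIP FUP).
apply/seteqP; split=> O; last first.
  by move=> [oO /oO[a Fa aO]]; exact: Fup Fa oO aO.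
move=> FO; have oO := Fo _ FO; split=> //.
(* [O] is the union of its basic open subsets, so complete primeness puts one of them in [F], and
   the point belongs to that one. *)
pose D := [set U | exists2 a, basic_open a `<=` O & basic_open a = U].
have DO : \bigcup_(U in D) U = O.
  apply/seteqP; split=> [P [_ [a aO <-]]|P /oO[a Pa aO]]; first exact: aO.
  by exists (basic_open a) => //; exists a.
have [||_ [a aO <-] Fa] := Fpr D; last exact: aO.
  by move=> _ [a _ <-]; exact: open_basic_open.
by rewrite DO.
Qed.

Let spectrum_setI : setI_closed (compact_opens (prime_filter A)).
Proof.
move=> _ _ /compact_opensE[a ->] /compact_opensE[b ->].
by apply/compact_opensE; exists (a `&` b)%O; rewrite basic_openI.
Qed.

Let spectrum_basis : basis (compact_opens (prime_filter A)).
Proof.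
split=> [U []//|P O]; rewrite nbhsE => -[O' [oO' /oO'[a Pa aO']] O'O].
exists (basic_open a); last exact: subset_trans O'O.
by split=> //; apply/compact_opensE; exists a.
Qed.

HB.instance Definition _ := isSpectral.Build (prime_filter A)
  spectrum_compact spectrum_kolmogorov spectrum_sober spectrum_setI
  spectrum_basis.

End Spectrum.
Arguments open_basic_open {d A} a.
Arguments compact_basic_open {d A} a.

(** * The involution on the spectrum of a De Morgan algebra *)

Section DeMorganSpectrum.
Context {d : Order.disp_t} {A : deMorganType d}.
Implicit Types (a b : A) (P : prime_filter A).

Lemma dmneg_le a b : (dmneg a <= dmneg b)%O = (b <= a)%O.
Proof.
by apply/idP/idP => /dmneg_anti //; rewrite !dmnegK.
Qed.

Lemma le_dmnegr a b : (a <= dmneg b)%O = (b <= dmneg a)%O.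
Proof. by rewrite -{1}[a]dmnegK dmneg_le. Qed.

(** An antitone involution is an anti-automorphism of the order, so it exchanges suprema and
    infima. *)
Lemma dmnegU a b : dmneg (a `|` b)%O = (dmneg a `&` dmneg b)%O.
Proof.
apply/le_anti; rewrite lexI !dmneg_le leUl leUr le_dmnegr leUx /=.
by rewrite (le_dmnegr a) (le_dmnegr b) leIl leIr.
Qed.

Lemma dmnegI a b : dmneg (a `&` b)%O = (dmneg a `|` dmneg b)%O.
Proof. by rewrite -[RHS]dmnegK dmnegU !dmnegK. Qed.

Lemma dmneg0 : dmneg \bot%O = \top%O :> A.
Proof.
by apply/le_anti; rewrite lex1 -[X in (X <= _)%O]dmnegK dmneg_le le0x.
Qed.

Lemma dmneg1 : dmneg \top%O = \bot%O :> A.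
Proof. by rewrite -dmneg0 dmnegK. Qed.

(** The complement of a prime filter is a prime ideal, which [dmneg] carries back to a prime
    filter. *)
Definition pf_inv P : prime_filter A.
Proof.
exists [set a | ~ P (dmneg a)] => /= [||a b|a b].
- by rewrite dmneg0; apply; exact: pf1.
- by rewrite dmneg1; exact: pf0.
- by rewrite dmnegI pfU; tauto.
- by rewrite dmnegU pfI not_andE.
Defined.

Lemma spectrum_specialization (P Q : prime_filter A) :
  specialization P Q <-> pf_set P `<=` pf_set Q.
Proof.
split=> [PQ a Pa|PQ U oU /oU[a Pa aU]]; last by apply: aU; exact: PQ.
by have /(_ Pa) := PQ _ (open_basic_open a).
Qed.

Let pf_inv_anti P Q :
  specialization P Q -> specialization (pf_inv Q) (pf_inv P).
Proof.
move=> /spectrum_specialization PQ; apply/spectrum_specialization => a /=.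
by apply: contra_not; exact: PQ.
Qed.

Let pf_invK : involutive pf_inv.
Proof. by move=> P; apply: pf_ext => a /=; rewrite dmnegK notK. Qed.

Let pf_inv_star (U : set (prime_filter A)) :
  compact_opens (prime_filter A) U ->
  compact_opens (prime_filter A) [set P | ~ U (pf_inv P)].
Proof.
(* The complement in the star operation cancels the one in [pf_inv]. *)
move=> /compact_opensE[a ->]; apply/compact_opensE; exists (dmneg a).
by apply/seteqP; split=> P /=; rewrite /basic_open /= notK.
Qed.

HB.instance Definition _ := isDeMorganSpectral.Build (prime_filter A)
  pf_inv_anti pf_invK pf_inv_star.

End DeMorganSpectrum.

(** * The De Morgan algebra of compact open sets *)

Record compact_open (X : topologicalType) := CompactOpen {
  co_set :> X -> Prop;
  co_compact : compact (co_set : set X);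
  co_open : open (co_set : set X)
}.

Lemma co_ext (X : topologicalType) (U V : compact_open X) :
  co_set U = co_set V -> U = V.
Proof.
case: U V => [U cU oU] [V cV oV] /= UV.
by case: V / UV in cV oV *; f_equal; exact: Prop_irrelevance.
Qed.

HB.instance Definition _ (X : topologicalType) := gen_eqMixin (compact_open X).
HB.instance Definition _ (X : topologicalType) :=
  gen_choiceMixin (compact_open X).

Lemma co_basis (X : spectralType) (O : set X) x : open O -> O x ->
  exists2 U : compact_open X, U x & co_set U `<=` O.
Proof.
move=> oO Ox; have [_ /(_ x O)[]] := @spectral_basis X.
  by apply: open_nbhs_nbhs.
by move=> U [[cU oU] Ux] UO; exists (CompactOpen cU oU).
Qed.

Section CompactOpenLattice.
Variable X : spectralType.
Implicit Types U V W : compact_open X.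

Definition co_le U V := `[< co_set U `<=` co_set V >].
Definition co_lt U V := (V != U) && co_le U V.

Definition co_bottom : compact_open X := CompactOpen (@compact0 X) (@open0 X).
Definition co_top : compact_open X :=
  CompactOpen (@spectral_compact X) (@openT X).
(** Compactness of an intersection is specific to spectral spaces and comes from [spectral_setI];
    that of a union holds in every space. *)
Definition co_meet U V : compact_open X :=
  let UV := @spectral_setI X _ _ (conj (@co_compact _ U) (@co_open _ U))
    (conj (@co_compact _ V) (@co_open _ V)) in
  CompactOpen UV.1 UV.2.
Definition co_join U V : compact_open X :=
  CompactOpen (compactU (@co_compact _ U) (@co_compact _ V))
    (openU (@co_open _ U) (@co_open _ V)).

Let co_le_def U V : co_le U V = (co_meet U V == U).
Proof.
apply/asboolP/eqP => [UV|<- x []//]; apply: co_ext.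
exact/setIidPl.
Qed.

Let co_meetC : commutative co_meet.
Proof. by move=> U V; apply: co_ext; exact: setIC. Qed.

Let co_joinC : commutative co_join.
Proof. by move=> U V; apply: co_ext; exact: setUC. Qed.

Let co_meetA : associative co_meet.
Proof. by move=> U V W; apply: co_ext; exact: setIA. Qed.

Let co_joinA : associative co_join.
Proof. by move=> U V W; apply: co_ext; exact: setUA. Qed.

Let co_joinKI V U : co_meet U (co_join U V) = U.
Proof. by apply: co_ext; rewrite /= setUC; exact: setKU. Qed.

Let co_meetKU V U : co_join U (co_meet U V) = U.
Proof. by apply: co_ext; rewrite /= setIC; exact: setKI. Qed.

Let co_meetUl : left_distributive co_meet co_join.
Proof. by move=> U V W; apply: co_ext; exact: setIUl. Qed.

Let co_meetxx : idempotent_op co_meet.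
Proof. by move=> U; apply: co_ext; exact: setIid. Qed.

(** The display is [demorgan_display] so that these lattices can be objects of [DM]. *)
HB.instance Definition _ := Order.isMeetJoinDistrLattice.Build
  demorgan_display (compact_open X) co_le_def (fun _ _ => erefl)
  co_meetC co_joinC co_meetA co_joinA co_joinKI co_meetKU co_meetUl co_meetxx.

Lemma co_leP U V : reflect (co_set U `<=` co_set V) (U <= V)%O.
Proof. exact: asboolP. Qed.

Let co_bottom_le U : (co_bottom <= U)%O.
Proof. by apply/co_leP. Qed.

Let co_le_top U : (U <= co_top)%O.
Proof. by apply/co_leP. Qed.

HB.instance Definition _ := Order.hasBottom.Build demorgan_display
  (compact_open X) co_bottom_le.
HB.instance Definition _ := Order.hasTop.Build demorgan_display
  (compact_open X) co_le_top.

End CompactOpenLattice.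

Section CompactOpenDeMorgan.
Variable X : deMorganSpectralType.
Implicit Types U V : compact_open X.

Definition co_star U : compact_open X :=
  let U' := @dminv_star X _ (conj (@co_compact _ U) (@co_open _ U)) in
  CompactOpen U'.1 U'.2.

Let co_star_anti U V : (U <= V)%O -> (co_star V <= co_star U)%O.
Proof.
by move=> /co_leP UV; apply/co_leP => x /=; apply: contra_not; exact: UV.
Qed.

Let co_starK : involutive co_star.
Proof.
by move=> U; apply: co_ext; apply/seteqP; split=> x /=; rewrite dminvK notK.
Qed.

HB.instance Definition _ := isDeMorgan.Build demorgan_display
  (compact_open X) co_star_anti co_starK.

End CompactOpenDeMorgan.

(** * Action on morphisms, by inverse image in both directions *)

Section SpectrumMap.
Context {d d' : Order.disp_t} {A : deMorganType d} {B : deMorganType d'}.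
Variable h : dmhom A B.

Definition pf_preimage (P : prime_filter B) : prime_filter A.
Proof.
exists [set a | P (h a)] => /= [||a b|a b].
- by rewrite dmhom0; exact: pf0.
- by rewrite dmhom1; exact: pf1.
- by rewrite dmhomI pfI.
- by rewrite dmhomU pfU.
Defined.

Definition spectrum_map :
  spectral_frame_morphism (prime_filter B) (prime_filter A).
Proof.
exists pf_preimage => [_ /compact_opensE[a ->]|P].
  by apply/compact_opensE; exists (h a).
by apply: pf_ext => a /=; rewrite dmhomN.
Defined.

End SpectrumMap.

Section CompactOpenMap.
Context {X Y : deMorganSpectralType}.
Variable f : spectral_frame_morphism X Y.

Definition co_preimage (U : compact_open Y) : compact_open X :=
  let fU := sfm_spectral f (conj (@co_compact _ U) (@co_open _ U)) in
  CompactOpen fU.1 fU.2.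

Definition compact_open_map : dmhom (compact_open Y) (compact_open X).
Proof.
exists co_preimage => [U V|U V|U||]; apply: co_ext => //.
by apply/seteqP; split=> x /=; rewrite sfm_dminv.
Defined.

End CompactOpenMap.

(** * The isomorphism of an algebra with the compact opens of its spectrum *)

Section AlgebraUnit.
Context {d : Order.disp_t} (A : deMorganType d).

Definition basic_co (a : A) : compact_open (prime_filter A) :=
  CompactOpen (compact_basic_open a) (open_basic_open a).

Definition basic_co_hom : dmhom A (compact_open (prime_filter A)).
Proof.
exists basic_co => [a b|a b|a||]; apply: co_ext.
- exact: basic_openI.
- exact: basic_openU.
- by apply/seteqP; split=> P /=; rewrite /basic_open /= notK.
- exact: basic_open0.
- exact: basic_open1.
Defined.

(** Surjectivity is [compact_opensE], injectivity is [basic_open_le]; the inverse is obtained by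
    choice. *)
Lemma basic_co_bij : exists g, cancel g basic_co /\ cancel basic_co g.
Proof.
have /choice[g gK] : forall U, exists a, basic_co a = U.
  move=> U; have /compact_opensE[a Ua] := conj (@co_compact _ U) (@co_open _ U).
  by exists a; apply: co_ext.
exists g; split=> // a; have /(congr1 (@co_set _)) /= gaE := gK (basic_co a).
by apply/le_anti/andP; split; apply: basic_open_le; rewrite gaE.
Qed.

End AlgebraUnit.

Section DMHomInverse.
Context {d d' : Order.disp_t} {A : deMorganType d} {B : deMorganType d'}.
Variables (h : dmhom A B) (g : B -> A).
Hypotheses (gK : cancel g h) (hK : cancel h g).

(** Makes a bijective homomorphism an isomorphism in [DM]. *)
Definition dmhom_inv : dmhom B A.
Proof.
by exists g => [a b|a b|a||]; apply: (can_inj hK);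
  rewrite ?(dmhomI, dmhomU, dmhomN, dmhom0, dmhom1) !gK.
Defined.

End DMHomInverse.

(** * The isomorphism of a space with the spectrum of its compact opens *)

Section SpaceUnit.
Variable X : deMorganSpectralType.

Definition point_pf (x : X) : prime_filter (compact_open X).
Proof. by exists (fun U : compact_open X => U x). Defined.

(** The space is Kolmogorov, and a separating neighbourhood can be shrunk to a compact open one
    because these form a basis. *)
Lemma point_pf_inj : injective point_pf.
Proof.
move=> x y xy; apply: contrapT => /eqP /spectral_kolmogorov[O].
have sep z t : point_pf z = point_pf t -> O \in nbhs z -> t \in ~` O -> False.
  move=> zt; rewrite !inE nbhsE => -[O' [oO' O'z] O'O]; apply.
  have [U Uz UO'] := co_basis oO' O'z; apply/O'O/UO'.
  by have : point_pf z U := Uz; rewrite zt.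
by case=> -[]; [exact: sep|exact/sep].
Qed.

(* The filter of opens generated by [P] is completely prime: were [O] in it the
   union of opens outside it, a member of [P] would be covered by the compact
   opens not in [P], which form a directed family because [P] is prime. *)
Lemma point_pf_surj (P : prime_filter (compact_open X)) :
  exists x, point_pf x = P.
Proof.
pose F := [set O : set X | open O /\ exists2 U, P U & co_set U `<=` O].
have [|x Fx] := @spectral_sober X F.
  split.
  - by move=> O [].
  - by split; [exact: openT|exists (co_top X) => //; exact: pf1].
  - move=> O O' [_ [U PU UO]] oO' OO'; split=> //; exists U => //.
    exact: subset_trans OO'.
  - move=> O O' [oO [U PU UO]] [oO' [V PV VO]]; split; first exact: openI.
    by exists (U `&` V)%O; [exact/pfI|exact: setISS].
  - move=> D Dop [_ [U PU UD]]; apply: contrapT => nD.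
    have [||||_ [V nPV <-] UV] := @compact_directed_cover _ _
        [set W | exists2 V : compact_open X, ~ P V & co_set V = W]
        (@co_compact _ U).
    + by move=> _ [V _ <-]; exact: co_open.
    + by exists set0; exists (co_bottom X) => //; exact: pf0.
    + move=> _ _ [V nPV <-] [W nPW <-]; exists (co_set (V `|` W)%O) => //.
      by exists (V `|` W)%O => //; rewrite pfU; tauto.
    + move=> x /UD[O DO Ox]; have [V Vx VO] := co_basis (Dop _ DO) Ox.
      exists (co_set V) => //; exists V => // PV; apply: nD; exists O => //.
      by split; [exact: Dop|exists V].
    by apply: nPV; apply: pf_le PU; exact/co_leP.
exists x; apply: pf_ext => U /=; split=> [Ux|PU].
  have : open_nbhs x (co_set U) by split=> //; exact: co_open.
  by rewrite -Fx => -[_ [V PV VU]]; apply: pf_le PV; exact/co_leP.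
have : F (co_set U) by split; [exact: co_open|exists U].
by rewrite Fx => -[].
Qed.

Definition point_sfm : spectral_frame_morphism X (prime_filter (compact_open X)).
Proof.
exists point_pf => [_ /compact_opensE[U ->]|x].
  by split; [exact: co_compact|exact: co_open].
by apply: pf_ext => U /=; rewrite notK.
Defined.

Lemma point_sfm_inv :
  exists g : spectral_frame_morphism (prime_filter (compact_open X)) X,
    cancel g point_sfm /\ cancel point_sfm g.
Proof.
have [g gK] := choice point_pf_surj.
have g_spectral : spectral_map g.
  move=> K [cK oK]; apply/compact_opensE; exists (CompactOpen cK oK).
  (* Since [P] is the prime filter of the point [g P], the inverse image of [K] under [g] is the
     basic open set of [K]. *)
  have gP (P : prime_filter _) : P (CompactOpen cK oK) = K (g P) by rewrite -{1}[P]gK.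
  by apply/seteqP; split=> P; rewrite /basic_open /= gP.
have g_dminv : {morph g : P / dminv P}.
  (* The inverse commutes with the involutions because [point_sfm] does and is injective. *)
  move=> P; apply: point_pf_inj; rewrite gK.
  by rewrite [RHS](sfm_dminv point_sfm) /= gK.
exists (SpectralFrameMorphism g_spectral g_dminv); split=> // x /=.
exact: point_pf_inj.
Qed.

End SpaceUnit.

(** * The two functors and the duality *)

Definition spectrum_functor : functor (opposite DM) DMSpec.
Proof.
refine (@Functor (opposite DM) DMSpec
  (fun A : deMorganType demorgan_display =>
    (prime_filter A : deMorganSpectralType))
  (fun A B h => spectrum_map h) _ _).
- by move=> A; apply: sfm_ext => P; exact: pf_ext.
- by move=> A B C g f; apply: sfm_ext => P; exact: pf_ext.
Defined.

Definition compact_open_functor : functor DMSpec (opposite DM).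
Proof.
refine (@Functor DMSpec (opposite DM)
  (fun X : deMorganSpectralType =>
    (compact_open X : deMorganType demorgan_display))
  (fun X Y f => compact_open_map f) _ _).
- by move=> X; apply: dmhom_ext => U; exact: co_ext.
- by move=> X Y Z g f; apply: dmhom_ext => U; exact: co_ext.
Defined.

Theorem theorem3p29 : dually_equivalent DM DMSpec.
Proof.
exists spectrum_functor, compact_open_functor; split.
(* A component from [A] to its double dual in [opposite DM] is a homomorphism into [A], hence the
   inverse of [basic_co_hom A]. *)
- have inv (A : deMorganType demorgan_display) :
      {g : dmhom (compact_open (prime_filter A)) A |
        cancel g (basic_co_hom A) /\ cancel (basic_co_hom A) g}.
    apply: cid; have [g [gK hK]] := basic_co_bij A.
    by exists (dmhom_inv (h := basic_co_hom A) gK hK).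
  exists (fun A => sval (inv A)); split=> [A B h|A].
    apply: dmhom_ext => U /=; case: (inv A) => f [fK Kf].
    (* Applying [basic_co_hom A] to both sides and writing [U] as the image of [g U] reduces
       naturality of the inverses to that of [basic_co_hom], where both sides have the same
       underlying set by conversion. *)
    case: (inv B) => g [gK Kg] /=; apply: (can_inj Kf).
    by rewrite fK -[in RHS](gK U); exact: co_ext.
  case: (inv A) => g [gK Kg]; exists (basic_co_hom A).
  by split; apply: dmhom_ext.
(* Here too the components point from the double dual to [X], so they are the inverses of
   [point_sfm], and naturality is reduced in the same way. *)
- have inv (X : deMorganSpectralType) := cid (point_sfm_inv X).
  exists (fun X => sval (inv X)); split=> [X Y f|X].
    apply: sfm_ext => P /=; case: (inv X) => g [gK Kg].
    case: (inv Y) => g' [gK' Kg'] /=; apply: (can_inj Kg'); rewrite gK'.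
    by rewrite -[in LHS](gK P); exact: pf_ext.
  case: (inv X) => g [gK Kg]; exists (point_sfm X).
  by split; apply: sfm_ext.
Qed.
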